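(* Let $n\geq 1$ and $0\leq t\leq\binom{n}{2}$ be integers. For an integer $s$ let $I_n(s)$ be the number of permutations of $\{1,\ldots,n\}$ with exactly $s$ inversions. Then $$\sum_{i=0}^t I_n(i)=\binom{n+t}{t}+\sum_{j=1}^n\ \sum_{k=\binom{j+1}{2}}^{\binom{n+1}{2}}(-1)^j\,[q^{\,k-\binom{j+1}{2}}]\Big[{n\atop j}\Big]_q\cdot\binom{t-k+n}{n}_0,$$ where $[q^m]\Big[{n\atop j}\Big]_q$ denotes the coefficient of $q^m$ in the Gaussian polynomial $\Big[{n\atop j}\Big]_q$.
   Context: An inversion of a permutation $(a_1,\ldots,a_n)$ of $\{1,\ldots,n\}$ is a pair $(a_i,a_j)$ with $i<j$ and $a_i>a_j$. The restricted binomial coefficient is defined for integers $a$ and $k\ge0$ by $\binom{a}{k}_0=\binom{a}{k}$ if $a\geq k$ and $\binom{a}{k}_0=0$ otherwise. The $q$-factorial is $[m]_q!=(1+q)(1+q+q^2)\cdots(1+q+\cdots+q^{m-1})$ (with $[0]_q!=[1]_q!=1$), and the Gaussian polynomial (q-binomial coefficient) is $\Big[{n\atop m}\Big]_q=\frac{[n]_q!}{[n-m]_q!\,[m]_q!}$ for $0\le m\le n$, which is a polynomial in $q$ with integer coefficients. *)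

(* Defs.v *)
From HB Require Import structures.
From mathcomp Require Import all_boot all_order all_fingroup all_algebra.
Set Implicit Arguments.
Unset Strict Implicit.
Unset Printing Implicit Defensive.
Import Order.TTheory GRing.Theory Num.Theory.
Local Open Scope ring_scope.

(* The permutation (a_1, ..., a_n) is s : 'S_n with a_(i+1) = s i + 1; an
   inversion is recorded as the pair of values (a_i, a_j). *)
Definition inversions (n : nat) (s : 'S_n) : {set 'I_n * 'I_n} :=
  [set (s ij.1, s ij.2) | ij : 'I_n * 'I_n
     & (ij.1 < ij.2)%N && (s ij.2 < s ij.1)%N].

Definition inv_count (n m : nat) : nat :=
  #|[set s : 'S_n | #|inversions s| == m]|.

Definition binom0 (a : int) (k : nat) : int :=
  if k%:Z <= a then 'C(`|a|%N, k)%:Z else 0.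

Definition qfact (m : nat) : {poly int} :=
  \prod_(2 <= i < m.+1) \sum_(l < i) 'X^l.

(* The divisor is monic, so %/ is Euclidean division in {poly int}, without
   the scaling of pseudo-division.  Meaningful for m <= n. *)
Definition qbinom (n m : nat) : {poly int} :=
  qfact n %/ (qfact (n - m) * qfact m).

(* Main.v *)
(** Inserting a first letter of value [j] creates [j] new inversions, so the
    generating polynomial of the inversion statistic is [qfact n].  Hence
    [(1 - X)^n * qfact n] is the product of the [1 - X^i], which the q-binomial
    theorem expands into Gaussian polynomials.  Extracting the coefficient of
    [X^t] after division by [(1 - X)^(n+1)] gives the partial sums on one side
    and the binomial coefficients on the other. *)

Require Import Defs.
From mathcomp Require Import all_boot all_order all_fingroup all_algebra.
From mathcomp Require Import ring zify.
Import Order.TTheory GRing.Theory Num.Theory.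
Local Open Scope ring_scope.

(** Injectivity of [s] lets positions stand for values; the double sum can then be split at position
    0. *)
Lemma card_inversions (n : nat) (s : 'S_n) :
  #|inversions s| = (\sum_(i < n) \sum_(j < n) ((i < j) && (s j < s i)))%N.
Proof.
rewrite /inversions card_imset; last first.
  by move=> [a b] [c d] [/perm_inj -> /perm_inj ->].
rewrite pair_bigA /= -sum1_card big_mkcond /=.
by apply: eq_bigr => -[i j] _; rewrite inE /=; case: (_ && _).
Qed.

Lemma ltn_bump2 (h i j : nat) : (bump h i < bump h j)%N = (i < j)%N.
Proof. by rewrite /bump; case: leqP; case: leqP; lia. Qed.

Lemma sum_bump_lt (n : nat) (h : 'I_n.+1) :
  (\sum_(k < n) (bump h k < h))%N = h.
Proof.
rewrite (eq_bigr (fun k : 'I_n => (k < h) : nat)); last first.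
  by move=> k _; rewrite /bump; case: (leqP h k) => /=; lia.
rewrite -[LHS](big_mkord xpredT (fun k => (k < h) : nat)).
have hn : (h <= n)%N by rewrite -ltnS.
rewrite (big_cat_nat (n := h)) //= [X in (_ + X)%N]big_nat_cond.
rewrite [X in (_ + X)%N]big1 ?addn0; last by move=> k; lia.
rewrite big_nat_cond (eq_bigr (fun=> 1%N)); last by move=> k; lia.
by rewrite -big_nat_cond sum_nat_const_nat subn0 muln1.
Qed.

(** Exactly [h] later values lie below the first letter [h], and skipping the value [h] preserves
    order, so the remaining pairs are inverted as in [s]. *)
Lemma card_inversions_lift_perm (n : nat) (h : 'I_n.+1) (s : 'S_n) :
  #|inversions (lift_perm ord0 h s)| = (h + #|inversions s|)%N.
Proof.
rewrite !card_inversions big_ord_recl big_ord_recl /= add0n; congr (_ + _)%N.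
  rewrite lift_perm_id -[in RHS](sum_bump_lt n h) [RHS](reindex_perm s) /=.
  by apply: eq_bigr => j _; rewrite lift_perm_lift.
apply: eq_bigr => i _; rewrite big_ord_recl /= add0n.
by apply: eq_bigr => j _; rewrite !lift_perm_lift /= !ltn_bump2.
Qed.

Lemma lift_perm_bij (n : nat) :
  bijective (fun p : 'I_n.+1 * 'S_n => lift_perm ord0 p.1 p.2).
Proof.
apply: inj_card_bij; last by rewrite card_prod card_ord !card_Sn factS.
move=> [h s] [h' s'] /= /permP eqL.
have eqh : h = h' by move: (eqL ord0); rewrite !lift_perm_id.
rewrite -eqh in eqL *; congr pair; apply/permP => i.
by move: (eqL (lift ord0 i)); rewrite !lift_perm_lift => /lift_inj.
Qed.

Lemma qfactS (m : nat) : qfact m.+1 = qfact m * \sum_(l < m.+1) 'X^l.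
Proof.
case: m => [|m]; last by rewrite /qfact big_nat_recr.
by rewrite /qfact !big_geq // big_ord1 mulr1.
Qed.

Lemma sum_inversions (n : nat) :
  \sum_(s : 'S_n) 'X^#|inversions s| = qfact n.
Proof.
elim: n => [|n IHn].
  rewrite /qfact big_geq // (eq_bigr (fun=> 1)); last first.
    by move=> s _; rewrite card_inversions big_ord0 expr0.
  by rewrite sumr_const card_Sn.
rewrite qfactS -IHn (reindex _ (onW_bij _ (lift_perm_bij n))) mulrC.
rewrite big_distrlr pair_bigA /=.
by apply: eq_bigr => -[h s] _ /=; rewrite card_inversions_lift_perm exprD.
Qed.

Lemma coef_qfact (n i : nat) : (qfact n)`_i = (inv_count n i)%:Z.
Proof.
rewrite -sum_inversions coef_sum /inv_count -sum1_card -natz natr_sum.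
rewrite [RHS]big_mkcond /=; apply: eq_bigr => s _.
by rewrite coefXn inE eq_sym; case: eqP.
Qed.

(** Gaussian polynomials through the q-Pascal rule: free of division, hence suited to induction. *)
Fixpoint gauss (n m : nat) : {poly int} :=
  match n, m with
  | _, 0 => 1
  | 0, _.+1 => 0
  | n'.+1, m'.+1 => gauss n' m' + 'X^m * gauss n' m
  end.

Lemma gaussn0 (n : nat) : gauss n 0 = 1.
Proof. by case: n. Qed.

Lemma gauss_small (n m : nat) : (n < m)%N -> gauss n m = 0.
Proof.
elim: n m => [|n IHn] [|m] //= ltnm.
by rewrite !IHn ?mulr0 ?addr0 //; lia.
Qed.

Lemma gauss_qfact (m k : nat) :
  gauss (m + k) m * (qfact k * qfact m) = qfact (m + k).
Proof.
have qf0 : qfact 0 = 1 by rewrite /qfact big_geq.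
elim: m k => [|m IHm] k; first by rewrite gaussn0 qf0 mulr1 mul1r.
elim: k => [|k IHk].
  have g1 p : gauss p p = 1.
    by elim: p => //= p ->; rewrite gauss_small ?mulr0 ?addr0.
  by rewrite addn0 g1 qf0 !mul1r.
(* Splitting the last factor after [m.+1] terms matches the two summands of the q-Pascal rule. *)
have -> : qfact (m.+1 + k.+1) =
    qfact (m + k.+1) * (\sum_(l < m.+1) 'X^l + 'X^(m.+1) * \sum_(l < k.+1) 'X^l).
  rewrite addSn qfactS; congr (_ * _); rewrite -addSn big_split_ord /=.
  by rewrite mulr_sumr; under [X in _ + X]eq_bigr do rewrite exprD.
rewrite addSnnS in IHk.
rewrite mulrDr -{1}IHm -IHk addSn /= (qfactS k) (qfactS m).
ring.
Qed.

Lemma qfact_monic (m : nat) : qfact m \is monic.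
Proof.
elim: m => [|m IHm]; first by rewrite /qfact big_geq // monic1.
rewrite qfactS monicMl //.
have -> : \sum_(l < m.+1) 'X^l = \poly_(l < m.+1) 1 :> {poly int}.
  by rewrite poly_def; apply: eq_bigr => l _; rewrite scale1r.
by rewrite monicE lead_coef_poly.
Qed.

Lemma qbinomE (n m : nat) : (m <= n)%N -> qbinom n m = gauss n m.
Proof.
move=> lemn; rewrite /qbinom -{1}(subnKC lemn) -gauss_qfact subnKC //.
by rewrite Pdiv.IdomainMonic.mulpK // monicMl qfact_monic.
Qed.

Lemma q_binomial (n : nat) (x : {poly int}) :
  \prod_(i < n) (1 + 'X^i * x) = \sum_(j < n.+1) 'X^'C(j, 2) * gauss n j * x ^+ j.
Proof.
elim: n x => [|n IHn] x.
  by rewrite big_ord0 big_ord1 /= !mulr1.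
(* The factor at [i = 0] is [1 + x]; the others form the shorter product at ['X * x], hence the
   induction for all [x]. *)
rewrite big_ord_recl expr0 mul1r.
under eq_bigr do rewrite /= /bump add1n exprSr -mulrA.
rewrite IHn mulrDl mul1r mulr_sumr [X in X + _]big_ord_recl [RHS]big_ord_recl.
rewrite !gaussn0 -addrA.
congr (_ + _).
(* The added top term vanishes since [gauss n n.+1 = 0]; both sums now have the same range. *)
have -> : \sum_(i < n) 'X^'C(bump 0 i, 2) * gauss n (bump 0 i) * ('X * x) ^+ bump 0 i
  = \sum_(i < n.+1) 'X^'C(i.+1, 2) * gauss n i.+1 * ('X * x) ^+ i.+1.
  by rewrite [RHS]big_ord_recr /= gauss_small // mulr0 mul0r addr0.
rewrite -big_split /=; apply: eq_bigr => i _.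
rewrite /bump add1n /= binS bin1 !exprMn exprD !exprS.
ring.
Qed.

Lemma prod_one_sub_expX (n : nat) :
  \prod_(i < n) (1 - 'X^(i.+1)) =
  \sum_(j < n.+1) (-1) ^+ j *: ('X^'C(j.+1, 2) * gauss n j) :> {poly int}.
Proof.
(* The q-binomial theorem at [x = - 'X]; the exponents add up as ['C(j, 2) + j = 'C(j.+1, 2)]. *)
transitivity (\prod_(i < n) (1 + 'X^i * (- 'X : {poly int}))).
  by apply: eq_bigr => i _; rewrite mulrN exprSr.
rewrite q_binomial; apply: eq_bigr => j _.
rewrite binS bin1 [(- _) ^+ _ in LHS]exprNn exprD -mul_polyC rmorphXn rmorphN1.
ring.
Qed.

Lemma qfact_one_subX (n : nat) :
  (1 - 'X) ^+ n * qfact n = \prod_(i < n) (1 - 'X^(i.+1)).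
Proof.
elim: n => [|n IHn]; first by rewrite big_ord0 /qfact big_geq // mulr1.
rewrite qfactS [RHS]big_ord_recr /= -IHn -[1 - 'X^_]opprB subrX1 exprSr.
ring.
Qed.

(* The coefficient of [X^t] in [P / (1 - X)^(n+1)]. *)
Definition cumul (n t : nat) (P : {poly int}) : int :=
  \sum_(0 <= k < t.+1) P`_k * 'C(t - k + n, n)%:Z.

(** One factor [1 - X] of the denominator cancels. On coefficients this is summation by parts
    followed by Pascal's rule. *)
Lemma cumul_one_subX (n t : nat) (P : {poly int}) :
  cumul n.+1 t ((1 - 'X) * P) = cumul n t P.
Proof.
rewrite /cumul.
under eq_bigr do rewrite mulrBl mul1r coefB coefXM mulrBl.
rewrite sumrB [X in _ - X]big_nat_recl //= mul0r add0r.
(* The term [k = t] has no shifted partner; both binomials there equal 1. *)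
rewrite big_nat_recr //= [RHS]big_nat_recr //= subnn !add0n !binn.
rewrite addrAC; congr (_ + _).
rewrite -sumrB; apply: eq_big_nat => k /andP[_ ltkt].
rewrite -mulrBr; congr (_ * _).
have -> : (t - k + n.+1 = (t - k + n).+1)%N by lia.
have -> : (t - k.+1 + n.+1 = t - k + n)%N by lia.
by rewrite binS PoszD addrAC subrr add0r.
Qed.

Lemma cumul0 (t : nat) (P : {poly int}) :
  cumul 0 t P = \sum_(0 <= i < t.+1) P`_i.
Proof. by apply: eq_bigr => k _; rewrite bin0 mulr1. Qed.

(** After [n] cancellations a single division by [1 - X] remains, which produces partial sums. *)
Lemma cumul_one_subX_exp (n t : nat) (P : {poly int}) :
  cumul n t ((1 - 'X) ^+ n * P) = \sum_(0 <= i < t.+1) P`_i.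
Proof.
elim: n => [|n IHn]; first by rewrite mul1r cumul0.
by rewrite exprS -mulrA cumul_one_subX.
Qed.

Lemma cumul_sum (n t m : nat) (c : 'I_m -> int) (P : 'I_m -> {poly int}) :
  cumul n t (\sum_(j < m) c j *: P j) = \sum_(j < m) c j * cumul n t (P j).
Proof.
rewrite /cumul; under eq_bigr do rewrite coef_sum mulr_suml.
rewrite exchange_big /=; apply: eq_bigr => j _; rewrite mulr_sumr.
by apply: eq_bigr => k _; rewrite coefZ mulrA.
Qed.

(** As [t - k + n >= n] means [k <= t], the cutoff of [binom0] is the summation range of [cumul]. *)
Lemma binom0_subn (n t k : nat) :
  binom0 (t%:Z - k%:Z + n%:Z) n =
  if (k <= t)%N then 'C(t - k + n, n)%:Z else 0.
Proof.
rewrite /binom0; case: (leqP k t) => [lekt | ltkt]; last first.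
  by rewrite ifF //; lia.
rewrite ifT; last by lia.
by congr (Posz 'C(_, _)); lia.
Qed.

(* [binom0] vanishes beyond [t], so any upper bound past [t] gives the same sum. *)
Lemma cumul_mulXn (n t a N : nat) (P : {poly int}) :
  (a <= N)%N -> (t < N)%N ->
  cumul n t ('X^a * P) =
  \sum_(a <= k < N) P`_(k - a) * binom0 (t%:Z - k%:Z + n%:Z) n.
Proof.
move=> leaN lttN.
pose F k := ('X^a * P)`_k * binom0 (t%:Z - k%:Z + n%:Z) n.
transitivity (\sum_(0 <= k < N) F k).
  rewrite (big_cat_nat (n := t.+1)) //= [X in _ = _ + X]big1_seq ?addr0.
    by apply: eq_big_nat => k /andP[_ lekt]; rewrite /F binom0_subn ifT.
  move=> k; rewrite mem_index_iota /= => /andP[ltk _].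
  by rewrite /F binom0_subn leqNgt ltk mulr0.
rewrite (big_cat_nat (n := a)) //= big1_seq ?add0r.
  by apply: eq_big_nat => k /andP[leak _]; rewrite /F coefXnM ltnNge leak.
move=> k; rewrite mem_index_iota /= => ltka.
by rewrite /F coefXnM ltka mul0r.
Qed.

Theorem theorem3p2 (n t : nat) (hn : (1 <= n)%N) (ht : (t <= 'C(n, 2))%N) :
  \sum_(0 <= i < t.+1) (inv_count n i)%:Z =
  'C(n + t, t)%:Z +
  \sum_(1 <= j < n.+1) \sum_('C(j.+1, 2) <= k < ('C(n.+1, 2)).+1)
     (-1) ^+ j * (qbinom n j)`_(k - 'C(j.+1, 2)) * binom0 (t%:Z - k%:Z + n%:Z) n.
Proof.
under eq_bigr do rewrite -coef_qfact.
rewrite -(cumul_one_subX_exp n) qfact_one_subX prod_one_sub_expX cumul_sum.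
(* The term [j = 0] is [cumul n t 1], whose only nonzero contribution, at [k = 0], is the leading
   binomial. *)
rewrite big_ord_recl; congr (_ + _).
  rewrite gaussn0 !mul1r /cumul big_nat_recl //= big1 ?addr0.
    by rewrite coef1 subn0 mul1r addnC -[in LHS]bin_sub ?leq_addr // addKn.
  by move=> k _; rewrite coef1 mul0r.
rewrite big_add1 /= big_mkord; apply: eq_bigr => j _; rewrite /bump add1n.
have ltjn := ltn_ord j.
(* This bound exceeds [t] because [t <= 'C(n, 2) <= 'C(n.+1, 2)]. *)
rewrite (@cumul_mulXn _ _ _ ('C(n.+1, 2)).+1).
- rewrite mulr_sumr; apply: eq_bigr => k _.
  by rewrite mulrA qbinomE.
- by apply: leqW; apply: leq_bin2l.
- by rewrite ltnS (leq_trans ht) // leq_bin2l.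
Qed.
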